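(* Let $\Lambda$ be an admissible set, and for every $n\in\mathbb{Z}$ let $a_n$ denote the cardinality of $\Lambda\cap[n,n+1)$. If $$\limsup_{n\to\infty}\frac{a_n}{c^n}=\infty\quad\text{for every positive } c\in\mathbb{R},$$ then every admissible set $\Lambda'$ with $\Lambda\subset\Lambda'$ is type 2.
   Context: A set $\Lambda\subset\mathbb{R}$ is called admissible if it is countably infinite, unbounded, bounded from below, and has no finite accumulation points. Let $\mu$ denote Lebesgue measure on $\mathbb{R}$. For an admissible $\Lambda$ and a (Lebesgue) measurable $f:\mathbb{R}\to[0,+\infty)$, put $s(x)=\sum_{\lambda\in\Lambda}f(x+\lambda)$, $C(f,\Lambda)=\{x\in\mathbb{R}: s(x)<\infty\}$ and $D(f,\Lambda)=\{x\in\mathbb{R}: s(x)=\infty\}$. The set $\Lambda$ is type 1 if for every measurable $f:\mathbb{R}\to[0,+\infty)$ either $\mu(D(f,\Lambda))=0$ or $\mu(C(f,\Lambda))=0$. Otherwise $\Lambda$ is type 2. *)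

(* Defs.v *)
From HB Require Import structures.
From mathcomp Require Import all_boot all_order all_algebra.
From mathcomp Require Import finmap.
From mathcomp Require Import all_classical all_reals all_analysis.

Set Implicit Arguments.
Unset Strict Implicit.
Unset Printing Implicit Defensive.

Import Order.TTheory GRing.Theory Num.Theory.
Import numFieldNormedType.Exports.

Local Open Scope classical_set_scope.
Local Open Scope ring_scope.

Definition admissible (R : realType) (Lam : set R) : Prop :=
  [/\ countable Lam, infinite_set Lam, ~ bounded_set Lam,
      has_lbound Lam & limit_point Lam = set0].

(* R with the sigma-algebra of Lebesgue (not just Borel) measurable sets: the
   Caratheodory sigma-algebra on which [completed_lebesgue_measure] lives. By
   [completed_caratheodory_measurable] it is the completion of the Borel one. *)
Definition lebesgueType (R : realType) :=
  caratheodory_type ((@wlength R idfun)^*)%mu.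

Definition lebesgue_measurable_fun (R : realType) (f : R -> R) : Prop :=
  measurable_fun [set: lebesgueType R] (f : lebesgueType R -> measurableTypeR R).

(* The sum takes values in the extended reals; for nonnegative summands [esum]
   is the supremum of the finite partial sums. *)
Definition translate_sum (R : realType) (f : R -> R) (Lam : set R) (x : R)
    : \bar R :=
  (\esum_(l in Lam) (f (x + l))%:E)%E.

Definition conv_set (R : realType) (f : R -> R) (Lam : set R) : set R :=
  [set x | (translate_sum f Lam x < +oo)%E].

Definition div_set (R : realType) (f : R -> R) (Lam : set R) : set R :=
  [set x | translate_sum f Lam x = +oo%E].

Definition type1 (R : realType) (Lam : set R) : Prop :=
  forall f : R -> R, lebesgue_measurable_fun f -> (forall x, 0 <= f x) ->
    completed_lebesgue_measure (div_set f Lam) = 0%E \/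
    completed_lebesgue_measure (conv_set f Lam) = 0%E.

Definition type2 (R : realType) (Lam : set R) : Prop := ~ type1 Lam.

(* [fset_set A] is empty when [A] is infinite, but an admissible set meets
   every bounded interval in a finite set, so this is the true cardinality. *)
Definition unit_count (R : realType) (Lam : set R) (n : int) : nat :=
  #|` fset_set (Lam `&` `[n%:~R, (n + 1)%:~R[%classic) |%fset.

(* Main.v *)
Require Import Defs.
From HB Require Import structures.
From mathcomp Require Import all_boot all_order all_algebra.
From mathcomp Require Import finmap.
From mathcomp Require Import all_classical all_reals all_analysis.
From mathcomp Require Import zify ring lra.

Set Implicit Arguments.
Unset Strict Implicit.
Unset Printing Implicit Defensive.

Import Order.TTheory GRing.Theory Num.Theory.
Import numFieldNormedType.Exports.

(** Write [N n] for the number of points of the larger set below [n], and [u n]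
    for the number of its points in [n, n+1).  If [u n <= K * N n] held for all
    large [n], then [N] would grow at most by a factor [K + 1] at each step, so
    [u] would be dominated by a geometric sequence; the hypothesis on the limsup
    excludes this ([superexponential_jump]).  Hence for every [k] there are
    arbitrarily large [n] at which the set jumps: [u n > 2^k * N n].

    Such a jump separates the points [x] of [0, 1) from those of [2, 3).  Let
    [A] be a subset of [n, n+2).  A point [x] of [2, 3) can only have [x + l] in
    [A] for one of the [N n] points [l < n], so the [x] for which this happens
    form a set of measure at most [N n * mu A].  A point of [0, 1) has all the
    [u n] points of [n, n+1) at its disposal, and a set [A] of measure as small
    as [6 / u n] already catches half of [0, 1) ([small_hitting_set]).  The set
    [A] is made of cells of a fine grid chosen greedily: as long as less than
    half of the cells of [0, 1) are caught, averaging over the grid gives a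
    choice that catches at least [u n / 4] new ones ([popular_difference],
    [greedy_cover]).

    For the k-th of these jumps this yields [A_k] such that [x + l] lands in
    [A_k] for at least half of the [x] in [0, 1), but only for a set of [x] in
    [2, 3) of measure at most [6 / 2^k].  Let [f] be the indicator of the union
    of the [A_k].  The points of [0, 1) caught infinitely often have measure at
    least 1/2, and the sum diverges there.  By Borel-Cantelli almost every point
    of [2, 3) is caught finitely often, and the sum is finite there. *)

(** * Covering half of an integer interval by few translates *)

(** The set [l - F]; the differences that fall outside of ['I_m] are dropped. *)
Definition diffs m (F : {set 'I_m}) (l : 'I_(2 * m)) : {set 'I_m} :=
  [set i : 'I_m | [exists j in F, l == i + j :> nat]].

Definition covered m (F : {set 'I_m}) (L : {set 'I_(2 * m)}) : {set 'I_m} :=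
  \bigcup_(l in L) diffs F l.

Lemma card_translate m (F : {set 'I_m}) (i : 'I_m) :
  #|[set l : 'I_(2 * m) | i \in diffs F l]| = #|F|.
Proof.
have lt2 (j : 'I_m) : i + j < 2 * m.
  by have := ltn_ord i; have := ltn_ord j; lia.
pose g j := Ordinal (lt2 j).
have g_inj : injective g.
  by move=> j j' /(congr1 val) /= /addnI /val_inj.
rewrite -(card_imset _ g_inj); apply: eq_card => l; rewrite !inE.
apply/existsP/imsetP => [[j /andP[Fj /eqP lij]]|[j Fj ->]].
  by exists j => //; apply: val_inj.
by exists j; rewrite Fj /=.
Qed.

(** On average over the [2 * m] values of [l], the set [l - F] contains a
    proportion [#|F| / (2 * m)] of [U], since each [i] in [U] lies in exactly
    [#|F|] of these sets; some [l] reaches the average. *)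
Lemma popular_difference m (F U : {set 'I_m}) : 0 < m ->
  exists l, #|U| * #|F| <= 2 * m * #|U :&: diffs F l|.
Proof.
move=> m0; apply/existsP; rewrite -[[exists _, _]]negbK negb_exists.
apply/negP => /forallP small.
have count : \sum_l #|U :&: diffs F l| = #|U| * #|F|.
  rewrite (eq_bigr (fun l =>
    \sum_(i | (i \in U) && (i \in diffs F l)) 1)); last first.
    by move=> l _; rewrite -sum1_card; apply: eq_bigl => i; rewrite !inE.
  rewrite (exchange_big_dep (fun i => i \in U)) /=; last first.
    by move=> l i _ /andP[].
  rewrite -sum_nat_const; apply: eq_bigr => i Ui.
  rewrite -(card_translate F i) -sum1dep_card.
  by apply: eq_bigl => l; rewrite Ui.
have : \sum_(l < 2 * m) (2 * m * #|U :&: diffs F l| + 1) <=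
       \sum_(l < 2 * m) #|U| * #|F|.
  by apply: leq_sum => l _; rewrite addn1 ltnNge small.
rewrite big_split /= -big_distrr /= count !sum_nat_const card_ord muln1.
by rewrite -[leqRHS]addn0 leq_add2l; lia.
Qed.

(** While less than half of ['I_m] is covered, a popular difference of the
    uncovered half adds at least [#|F| / 4] new points; so [t] steps cover
    [t * #|F| / 4] points unless half of ['I_m] is reached before. *)
Lemma greedy_cover m (F : {set 'I_m}) (t : nat) : 0 < m ->
  exists2 L : {set 'I_(2 * m)}, #|L| <= t &
    (m <= 2 * #|covered F L|) || (t * #|F| <= 4 * #|covered F L|).
Proof.
move=> m0; elim: t => [|t [L Lt IH]].
  by exists finset.set0; rewrite ?cards0 ?orbT.
have [big|small] := leqP m (2 * #|covered F L|).
  by exists L; rewrite ?big // (leq_trans Lt).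
have {}IH : t * #|F| <= 4 * #|covered F L|.
  by case/orP: IH => //; rewrite leqNgt small.
have [l hl] := popular_difference F (~: covered F L) m0.
exists (l |: L); first by rewrite cardsU1 -[t.+1]add1n leq_add ?leq_b1.
have -> : #|covered F (l |: L)| =
    #|covered F L| + #|~: covered F L :&: diffs F l|.
  rewrite /covered finset.bigcup_setU big_set1 finset.setUC -cardsUI.
  set C := \bigcup_(_ in L) _.
  have -> : C :|: ~: C :&: diffs F l = C :|: diffs F l.
    by apply/setP => i; rewrite !inE; case: (i \in C).
  have -> : C :&: (~: C :&: diffs F l) = finset.set0.
    by apply/setP => i; rewrite !inE; case: (i \in C).
  by rewrite cards0 addn0.
set c := #|covered F L| in IH small hl *; set n := #|_ :&: _| in hl *.
have cC : c + #|~: covered F L| = m by rewrite cardsC card_ord.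
apply/orP; right; suff : #|F| <= 4 * n by lia.
rewrite leqNgt; apply/negP => lt4; nia.
Qed.

Local Open Scope classical_set_scope.
Local Open Scope ring_scope.

(** * Small sets that hit most translates of a finite set *)

Lemma measurable_translate (R : realType) (t : R) (A : set R) :
  measurable A -> measurable [set x | A (x + t)].
Proof.
move=> mA; rewrite -[X in measurable X]setTI.
have : measurable_fun setT (fun x : R => x + t).
  exact: measurable_realfun.measurable_funD.
exact.
Qed.

Lemma lebesgue_measure_translate (R : realType) (t : R) (A : set R) :
  measurable A -> lebesgue_measure [set x | A (x + t)] = lebesgue_measure A.
Proof.
move=> mA.
pose shift_t : measurableTypeR R -> measurableTypeR R := fun x => x + t.
have mt : measurable_fun setT shift_t.
  exact: measurable_realfun.measurable_funD.
pose nu := pushforward (@lebesgue_measure R) shift_t.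
rewrite [LHS](_ : _ = nu A)//; apply/esym.
apply: (lebesgue_measure_unique (mu := nu)) => //.
move=> _ [[a b] _ <-] /=; rewrite /nu /pushforward /=.
rewrite (_ : shift_t @^-1` `]a, b] = `]a - t, b - t]%classic); last first.
  by apply/seteqP; split => x; rewrite /shift_t /= !in_itv /= ltrBlDr lerBrDr.
rewrite !lebesgue_measure_itv /= !lte_fin ltrD2r; case: ifP => // _.
by rewrite -!EFinB; congr EFin; ring.
Qed.

(** A mesh finer than the gaps of [F] puts its points in distinct grid cells,
    so that no multiplicity is lost in the passage to the grid. *)
Lemma separating_mesh (R : realType) (F : {fset R}) :
  exists m : nat, {in F &, forall x y, x != y -> 1 <= m.+1%:R * `|x - y|}.
Proof.
pose d (p : R * R) := Num.truncn (`|p.1 - p.2|^-1).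
exists (\max_(p <- [seq (x, y) | x <- F, y <- F]) d p)%N => x y Fx Fy xy.
have /(leq_bigmax_seq (P := xpredT) (F := d)) /(_ isT) dm :
    (x, y) \in [seq (x, y) | x <- F, y <- F].
  exact: allpairs_f.
have xy0 : 0 < `|x - y| by rewrite normr_gt0 subr_eq0.
rewrite -ler_pdivrMr // div1r (le_trans (ltW (truncnS_gt _))) //.
by rewrite ler_nat ltnS.
Qed.

Lemma measure_bigcup_seq_le (d : measure_display) (T : measurableType d)
    (R : realType) (mu : {measure set T -> \bar R}) (I : choiceType)
    (s : seq I) (F : I -> set T) (A : set T) (c : R) :
  uniq s -> measurable A -> A `<=` \bigcup_(i in [set` s]) F i ->
  (forall i, i \in s -> measurable (F i)) ->
  (forall i, i \in s -> (mu (F i) <= c%:E)%E) ->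
  (mu A <= ((size s)%:R * c)%:E)%E.
Proof.
move=> us mA AF mF Fc.
have fs : finite_set [set` s] by [].
apply: (le_trans (content_sub_fsum mu fs mF mA AF)).
rewrite -fsbig_seq // big_seq (le_trans (lee_sum _ (g := fun=> c%:E) _)) //.
by rewrite -big_seq sumEFin big_const_seq count_predT iter_addr_0 mulr_natl.
Qed.

Lemma measure_bigcup_seq_eq (d : measure_display) (T : measurableType d)
    (R : realType) (mu : {measure set T -> \bar R}) (I : choiceType)
    (s : seq I) (F : I -> set T) (c : R) :
  uniq s -> trivIset [set` s] F ->
  (forall i, i \in s -> measurable (F i)) ->
  (forall i, i \in s -> mu (F i) = c%:E) ->
  mu (\bigcup_(i in [set` s]) F i) = ((size s)%:R * c)%:E.
Proof.
move=> us tF mF Fc; rewrite measure_fin_bigcup // -fsbig_seq // big_seq.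
rewrite (eq_bigr (fun=> c%:E)) // -big_seq sumEFin.
by rewrite big_const_seq count_predT iter_addr_0 mulr_natl.
Qed.

(** Both [0, 1) and [b, b + 1) are cut in [M = m.+1] cells, and [F] is replaced
    by the indices of its cells.  The sum of a point of cell [i] and a point of
    [F] in cell [j] lies in one of the two cells [i + j] and [i + j + 1], which
    is why each index [l] chosen by the greedy covering contributes a piece of
    length [2 / M].  About [2 * M / #|F|] pieces suffice. *)
Lemma small_hitting_set (R : realType) (F : {fset R}) (b : R) :
  (0 < #|` F|)%N -> (forall l, l \in F -> b <= l < b + 1) ->
  exists A E : set R,
   [/\ measurable A, A `<=` `[b, b + 2[ &
       (lebesgue_measure A <= (6 / #|` F|%:R)%:E)%E] /\
   [/\ measurable E, E `<=` `[0, 1[, (2^-1%:E <= lebesgue_measure E)%E &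
       forall x, E x -> exists2 l, l \in F & A (x + l)].
Proof.
move=> a0 Fb; have [m sep] := separating_mesh F.
set a := #|` F| in a0 *; set M : R := m.+1%:R in sep.
have M0 : 0 < M by rewrite ltr0n.
have aR0 : 0 < a%:R :> R by rewrite ltr0n.
pose idx (l : R) := Num.truncn (M * (l - b)).
have idxP l : l \in F -> (idx l)%:R <= M * (l - b) < (idx l).+1%:R.
  by move=> /Fb lb; apply: truncn_itv; apply: mulr_ge0; [exact: ltW|lra].
have idx_lt l : l \in F -> (idx l < m.+1)%N.
  move=> lF; have /andP[h _] := idxP _ lF; have := Fb _ lF => lb.
  by rewrite -(ltr_nat R); apply: le_lt_trans h _; rewrite -/M; nra.
pose g l : 'I_m.+1 := inord (idx l).
have gE l : l \in F -> g l = idx l :> nat by move=> lF; rewrite inordK ?idx_lt.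
have g_inj : {in F &, injective g}.
  move=> x y xF yF /(congr1 val) /=; rewrite !gE // => e.
  apply/eqP/negPn/negP => xy; have := sep _ _ xF yF xy.
  have := idxP _ xF; have := idxP _ yF; rewrite e -!natr1 => h1 h2.
  by rewrite leNgt => /negP; apply; case: (ler0P (x - y)) => _; lra.
pose Fi := [set j in [seq g l | l <- F]]%SET.
have cFi : #|Fi| = a.
  rewrite cardsE; have /card_uniqP -> : uniq [seq g l | l <- F].
    by rewrite (map_inj_in_uniq g_inj) fset_uniq.
  by rewrite size_map.
have aM : (a <= m.+1)%N by rewrite -cFi (leq_trans (max_card _)) ?card_ord.
(* With this many greedy steps, [t * a] reaches [2 * m.+1], which forces half
   of the cells to be covered; the rounding is absorbed by [a <= m.+1]. *)
pose t := ((2 * m.+1) %/ a).+1.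
have [L Lt cov] := greedy_cover Fi t (isT : (0 < m.+1)%N).
have ta : (2 * m.+1 <= t * a <= 3 * m.+1)%N.
  have -> : (t * a = 2 * m.+1 %/ a * a + a)%N by rewrite /t mulSn addnC.
  move: (divn_eq (2 * m.+1) a) (ltn_pmod (2 * m.+1) a0).
  by move: (_ %/ _ * _)%N (_ %% _)%N => q r; clear -aM; lia.
have {}cov : (m.+1 <= 2 * #|covered Fi L|)%N.
  move: cov; rewrite cFi => /orP[//|cov]; case/andP: ta => ta _.
  by have := leq_trans ta cov; clear; lia.
pose cell (i : 'I_m.+1) : set R := `[i%:R / M, i.+1%:R / M[%classic.
pose piece (l : 'I_(2 * m.+1)) : set R :=
  `[b + l%:R / M, b + l.+2%:R / M[%classic.
pose E : set R := \bigcup_(i in [set` enum (covered Fi L)]) cell i.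
(* The cut to [b, b + 2) loses no hit: for [x] in [0, 1) and [y] in
   [b, b + 1) the sum [x + y] is always there. *)
pose A : set R := `[b, b + 2[%classic `&` \bigcup_(l in [set` enum L]) piece l.
have mA : measurable A.
  apply: measurableI; first exact: measurable_itv.
  apply: fin_bigcup_measurable => [|i _]; first exact: finite_seq.
  exact: measurable_itv.
exists A, E; split; split.
- exact: mA.
- by move=> x [].
- apply: (@le_trans _ _ ((size (enum L))%:R * (2 / M))%:E).
    apply: (measure_bigcup_seq_le (mu := @lebesgue_measure R) (F := piece)).
    + exact: enum_uniq.
    + exact: mA.
    + by move=> x [].
    + by move=> i _; exact: measurable_itv.
    move=> i _; rewrite /piece /= lebesgue_measure_itv /= lte_fin.
    case: ifP => _; last by rewrite lee_fin divr_ge0 // ltW.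
    rewrite -EFinB lee_fin -[_.+2]addn2 natrD mulrDl.
    by move: (_ / M) (2 / M) => u v; lra.
  have sL : size (enum L) = #|L| by rewrite -cardE.
  rewrite sL lee_fin mulrA ler_pdivrMr // mulrAC ler_pdivlMr //.
  have /andP[_] := ta; rewrite -(ler_nat R) !natrM -/M => ta3.
  have : #|L|%:R * a%:R <= t%:R * a%:R :> R by rewrite ler_pM2r // ler_nat.
  by lra.
- apply: fin_bigcup_measurable => [|i _]; first exact: finite_seq.
  exact: measurable_itv.
- move=> x [i _]; rewrite /cell /= !in_itv /= => /andP[h1 h2].
  apply/andP; split; first by apply: le_trans h1; rewrite divr_ge0 // ltW.
  by apply: lt_le_trans h2 _; rewrite ler_pdivrMr // mul1r ler_nat.
- have -> : lebesgue_measure E = ((size (enum (covered Fi L)))%:R * M^-1)%:E.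
    apply: (measure_bigcup_seq_eq (mu := @lebesgue_measure R)) => //.
    + exact: enum_uniq.
    + move=> i j _ _ [x []]; rewrite /cell /= !in_itv /=.
      rewrite !ler_pdivrMr // !ltr_pdivlMr // => hi hj; apply: val_inj => /=.
      by rewrite -(truncn_def hi) -(truncn_def hj).
    + by move=> i _; exact: measurable_itv.
    + move=> i _; rewrite /cell /= lebesgue_measure_itv /= lte_fin.
      rewrite ltr_pM2r ?invr_gt0 // ltr_nat ltnSn -EFinB -natr1 mulrDl mul1r.
      by rewrite addrAC subrr add0r.
  have -> : size (enum (covered Fi L)) = #|covered Fi L| by rewrite -cardE.
  rewrite lee_fin ler_pdivlMr //.
  by move: cov; rewrite -(ler_nat R) natrM -/M => cov; lra.
- move=> x [i /=]; rewrite mem_enum => /bigcupP[l lL].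
  rewrite finset.inE => /exists_inP[j].
  rewrite finset.inE => /mapP[y yF ->] /eqP lij.
  rewrite /cell /= in_itv /= ler_pdivrMr // ltr_pdivlMr // => xi.
  exists y => //; have yj := idxP _ yF; rewrite gE // in lij.
  have yb := Fb _ yF.
  have x01 : 0 <= x < 1.
    have im : i.+1%:R <= M by rewrite ler_nat.
    have i0 : 0 <= i%:R :> R by [].
    by apply/andP; split; nra.
  split; first by rewrite /= in_itv /=; lra.
  exists l; first by rewrite /= mem_enum.
  rewrite /piece /= in_itv /= -lerBrDl -ltrBlDl ler_pdivrMr // ltr_pdivlMr //.
  by move: xi yj; rewrite lij -!natr1 natrD => xi yj; lra.
Qed.

(** * Jumps of the counting function *)

Lemma admissible_finite_below (R : realType) (Lam : set R) (b : R) :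
  admissible Lam -> finite_set (Lam `&` `]-oo, b[).
Proof.
move=> [_ _ _ [c cLam] lim0]; apply: contrapT => infL.
have bnd : bounded_set (Lam `&` `]-oo, b[).
  exists (`|c| + `|b|); split; first exact: num_real.
  move=> y cby x [/cLam cx]; rewrite /= in_itv /= => xb.
  apply: le_trans (ltW cby); rewrite ler_norml.
  have := ler_norm b; have := lerNnormlW (lexx `|c|).
  have := normr_ge0 b; have := normr_ge0 c.
  by move=> *; apply/andP; split; lra.
have [x xlim] := infinite_bounded_limit_point_nonempty infL bnd.
suff : limit_point Lam x by rewrite lim0.
by move=> U /xlim[y [yx [Ly _] Uy]]; exists y.
Qed.

Lemma limn_esup_pinfty_frequently (R : realType) (v : nat -> R) (B : R)
    (n0 : nat) :
  limn_esup (fun n => (v n)%:E) = +oo%E ->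
  exists2 n, (n0 <= n)%N & B < v n.
Proof.
move=> vy; apply: contrapT => noB.
have : (limn_esup (fun n => (v n)%:E) <= B%:E)%E.
  pose tail := [set n | (n0 <= n)%N].
  apply: (@le_trans _ _ (ereal_sup ((fun n => (v n)%:E) @` tail))).
    by apply: ereal_inf_lbound; exists tail => //; exists n0.
  apply: ge_ereal_sup => _ [n n0n <-]; rewrite lee_fin leNgt; apply/negP => Bv.
  by apply: noB; exists n.
by rewrite vy leye_eq.
Qed.

(** Without jumps after [n0], the recurrence gives
    [N (n0 + k) <= N n0 * (K + 1)^k], and then [u n / (K + 1)^n] is bounded by
    [K * N n0] for [n >= n0]. *)
Lemma superexponential_jump (R : realType) (u N : nat -> nat) :
  (forall n, N n.+1 = (N n + u n)%N) ->
  (forall c B n0, 0 < c :> R ->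
    exists2 n, (n0 <= n)%N & B < (u n)%:R / c ^+ n) ->
  forall K n0, exists2 n, (n0 <= n)%N & (K * N n < u n)%N.
Proof.
move=> NS freq K n0; apply: contrapT => slow.
have uN n : (n0 <= n)%N -> (u n <= K * N n)%N.
  by move=> n0n; rewrite leqNgt; apply/negP => lt; apply: slow; exists n.
have N_exp k : (N (n0 + k) <= N n0 * K.+1 ^ k)%N.
  elim: k => [|k IH]; first by rewrite addn0 muln1.
  rewrite addnS NS expnS; have := uN _ (leq_addr k n0).
  by move=> h; apply: leq_trans (leq_add (leqnn _) h) _; nia.
have [n n0n] := freq K.+1%:R (K * N n0)%:R n0 (ltr0Sn _ _).
rewrite ltr_pdivlMr ?exprn_gt0 // -natrX -natrM ltr_nat ltnNge => /negP; apply.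
apply: leq_trans (uN _ n0n) _; rewrite -mulnA leq_mul2l; apply/orP; right.
rewrite -{1}(subnKC n0n); apply: leq_trans (N_exp _) _.
by rewrite leq_mul2l leq_pexp2l ?leq_subr ?orbT.
Qed.

Definition count_below (R : realType) (Lam : set R) (b : R) : nat :=
  #|` fset_set (Lam `&` `]-oo, b[) |%fset.

Lemma admissible_finite_unit (R : realType) (Lam : set R) (n : nat) :
  admissible Lam -> finite_set (Lam `&` `[n%:R, n.+1%:R[).
Proof.
move=> /(admissible_finite_below n.+1%:R); apply: sub_finite_set => x [Lx].
by rewrite /= !in_itv /= => /andP[_ xn]; split => //=; rewrite in_itv.
Qed.

Lemma unit_countE (R : realType) (Lam : set R) (n : nat) :
  unit_count Lam n%:Z = #|` fset_set (Lam `&` `[n%:R, n.+1%:R[) |%fset.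
Proof. by rewrite /unit_count -natr1 intrD. Qed.

Lemma count_belowS (R : realType) (Lam : set R) (n : nat) : admissible Lam ->
  count_below Lam n.+1%:R = (count_below Lam n%:R + unit_count Lam n%:Z)%N.
Proof.
move=> adm; rewrite unit_countE /count_below.
have fB := admissible_finite_below n%:R adm.
have fU := admissible_finite_unit n adm.
rewrite -cardfsUI -fset_setU // -fset_setI //.
rewrite [X in (_ + #|` fset_set X|)%N](_ : _ = set0) ?fset_set0 ?cardfs0 ?addn0.
  rewrite -setIUr; congr #|` fset_set (_ `&` _)|; apply/seteqP; split => x /=.
    rewrite !in_itv /= => xn.
    by case: (ltP x n%:R) => nx; [left|right; rewrite xn].
  rewrite !in_itv /= => -[xn|/andP[]//].
  by apply: lt_trans xn _; rewrite ltr_nat.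
apply/seteqP; split => x // [[_ /=]]; rewrite !in_itv /= => xn [_ /andP[nx _]].
by move: xn; rewrite ltNge nx.
Qed.

Lemma le_unit_count (R : realType) (Lam Lam' : set R) (n : nat) :
  admissible Lam' -> Lam `<=` Lam' ->
  (unit_count Lam n%:Z <= unit_count Lam' n%:Z)%N.
Proof.
move=> adm LL'; rewrite !unit_countE; apply: fsubset_leq_card.
have fU := admissible_finite_unit n adm.
rewrite -fset_set_sub //; first exact: setSI.
by apply: sub_finite_set fU; exact: setSI.
Qed.

(** * Convergence and divergence for an indicator function *)

(** For an indicator the sum counts the translates that land in [A], so only
    the finiteness of their set matters. *)
Lemma translate_sum_indic (R : realType) (A Lam : set R) (x : R) :
  translate_sum \1_A Lam x =
  (\esum_(l in Lam `&` [set l | A (x + l)%R]) 1)%E.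
Proof.
rewrite esum_mkcondr; apply: eq_esum => l _.
have -> : (l \in [set l | A (x + l)]) = (x + l \in A).
  by apply/idP/idP; rewrite !inE.
by rewrite indicE; case: (_ \in A).
Qed.

Lemma conv_set_indic (R : realType) (A Lam : set R) (x : R) :
  finite_set (Lam `&` [set l | A (x + l)]) -> conv_set \1_A Lam x.
Proof.
move=> fS; rewrite /conv_set /= translate_sum_indic esum_fset //.
by rewrite fsbig_finite // sumEFin ltry.
Qed.

Lemma div_set_indic (R : realType) (A Lam : set R) (x : R) :
  infinite_set (Lam `&` [set l | A (x + l)]) -> div_set \1_A Lam x.
Proof.
move=> iS; rewrite /div_set /= translate_sum_indic; apply/eqyP => r r0.
have [B BS Br] := infinite_set_fset (Num.truncn r).+1 iS.
apply: esum_ge; exists [set` B]; first by split.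
rewrite -fsbig_seq ?fset_uniq // sumEFin lee_fin.
rewrite big_const_seq count_predT iter_addr_0.
by apply: ltW; apply: lt_le_trans (truncnS_gt _) _; rewrite ler_nat.
Qed.

(** * Building the function *)

(** The data extracted from the k-th jump, located at [jump_at].  The bound on
    [leaking] is the k-th term of a geometric series with sum 12. *)
Record stage (R : realType) (Lam : set R) (k : nat) : Type := Stage {
  jump_at : nat;
  target : set R;
  hitting : set R;
  leaking : set R;
  jump_at_ge : (k <= jump_at)%N;
  target_measurable : measurable target;
  target_sub : target `<=` `[jump_at%:R, jump_at.+2%:R[;
  hitting_measurable : measurable hitting;
  hitting_sub : hitting `<=` `[0, 1[;
  hitting_large : (2^-1%:E <= lebesgue_measure hitting)%E;
  hittingP : forall x, hitting x ->
    exists2 l, Lam l & jump_at%:R <= l /\ target (x + l);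
  leaking_measurable : measurable leaking;
  leaking_small : (lebesgue_measure leaking <= (12 / (2 ^ k.+1)%:R)%:E)%E;
  leakingP : forall x l, 2 <= x -> Lam l -> target (x + l) -> leaking x
}.

(** From [x >= 2] the target, which ends at [n + 2], is only reached with
    [l < n]; so [leaking] is a union of [count_below Lam n] translates of the
    target, and the jump makes its measure small. *)
Lemma stage_of_jump (R : realType) (Lam : set R) (k n : nat) :
  admissible Lam -> (k <= n)%N ->
  (2 ^ k * count_below Lam n%:R < unit_count Lam n%:Z)%N ->
  exists s : stage Lam k, True.
Proof.
move=> adm kn; rewrite unit_countE => jump.
have fU := admissible_finite_unit n adm.
have fB := admissible_finite_below n%:R adm.
set F := fset_set _ in jump.
have FP l : l \in F -> Lam l /\ n%:R <= l < n%:R + 1.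
  by rewrite in_fset_set // inE /= in_itv /= natr1.
have F0 : (0 < #|` F|)%N by apply: leq_trans jump.
have [A [E [[mA An Asmall] [mE E01 Ebig hit]]]] :=
  small_hitting_set F0 (fun l lF => (FP l lF).2).
pose G := \bigcup_(l in Lam `&` `]-oo, n%:R[) [set x | A (x + l)].
have mG : measurable G.
  by apply: fin_bigcup_measurable => // l _; exact: measurable_translate.
have An2 : A `<=` `[n%:R, n.+2%:R[.
  by move=> x /An; rewrite -[n.+2]addn2 natrD.
have Gsmall : (lebesgue_measure G <= (12 / (2 ^ k.+1)%:R)%:E)%E.
  have NA : (lebesgue_measure G <=
      ((count_below Lam n%:R)%:R * (6 / #|` F|%:R))%:E)%E.
    apply: (measure_bigcup_seq_le (mu := @lebesgue_measure R)
      (F := fun l => [set x | A (x + l)])).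
    + exact: fset_uniq.
    + exact: mG.
    + by rewrite fset_setK.
    + by move=> l _; exact: measurable_translate.
    + by move=> l _; rewrite /= lebesgue_measure_translate.
  apply: le_trans NA _.
  have -> : 12 / (2 ^ k.+1)%:R = 6 / (2 ^ k)%:R :> R.
    by rewrite expnS natrM invfM mulrA; congr (_ / _); lra.
  have k0 : 0 < (2 ^ k)%:R :> R by rewrite ltr0n expn_gt0.
  rewrite lee_fin mulrCA ler_pM2l // ler_pdivrMr ?ltr0n // mulrC ler_pdivlMr //.
  by rewrite -natrM ler_nat mulnC ltnW.
have hitE x : E x -> exists2 l, Lam l & n%:R <= l /\ A (x + l).
  by move=> /hit[l /FP[Ll /andP[nl _]] Axl]; exists l.
have leakG x l : 2 <= x -> Lam l -> A (x + l) -> G x.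
  move=> x2 Ll Axl; exists l => //; split => //=.
  by have := An _ Axl; rewrite /= !in_itv /= => /andP[_]; lra.
by exists (Stage kn mA An2 mE E01 Ebig hitE mG Gsmall leakG).
Qed.

(** Lebesgue measure and its completion are restrictions of one outer measure,
    and an outer measure is monotone on all sets. *)
Lemma completed_lebesgue_measure_gt0 (R : realType) (S B : set R) (c : R) :
  0 < c -> measurable B -> B `<=` S -> (c%:E <= lebesgue_measure B)%E ->
  completed_lebesgue_measure S <> 0%E.
Proof.
move=> c0 mB BS cB S0.
have : (lebesgue_measure B <= completed_lebesgue_measure S)%E.
  exact: (le_outer_measure ((@wlength R idfun)^*)%mu).
by rewrite S0 leNgt => /negP; apply; apply: lt_le_trans cB.
Qed.

Lemma lebesgue_measurable_indic (R : realType) (A : set R) :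
  measurable A -> lebesgue_measurable_fun (\1_A : R -> R).
Proof.
move=> mA; apply: measurable_realfun.measurable_indic.
by apply: sub_caratheodory.
Qed.

(** The sum of the indicator of the union of the targets diverges on the upper
    limit of the hitting sets, and converges on [2, 3) outside of the upper
    limit of the leaking sets. *)
Lemma type2_of_jumps (R : realType) (Lam : set R) : admissible Lam ->
  (forall K n0, exists2 n, (n0 <= n)%N &
    (K * count_below Lam n%:R < unit_count Lam n%:Z)%N) ->
  type2 Lam.
Proof.
move=> adm jump.
have {jump}stages k : {s : stage Lam k | True}.
  apply: cid; have [n kn nP] := jump (2 ^ k)%N k.
  exact: stage_of_jump kn nP.
pose S k := sval (stages k); move: S => {stages} S.
pose A k := target (S k); pose E k := hitting (S k); pose G k := leaking (S k).
have mA k : measurable (A k) by exact: target_measurable.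
have mE k : measurable (E k) by exact: hitting_measurable.
have mG k : measurable (G k) by exact: leaking_measurable.
pose U := \bigcup_k A k.
have mU : measurable U by exact: bigcup_measurable.
have supE_div : lim_sup_set E `<=` div_set \1_U Lam.
  move=> x xE; apply: div_set_indic => fin.
  (* Hits from later and later jumps use unboundedly large points of [Lam]. *)
  pose s := fset_set (Lam `&` [set l | U (x + l)]).
  pose b := (\max_(l <- s) (Num.truncn l).+1)%N.
  have [k /= bk /hittingP[l Ll [nl Axl]]] := xE b Logic.I.
  have ls : l \in s by rewrite in_fset_set // inE; split => //; exists k.
  have := truncnS_gt l; rewrite ltNge => /negP; apply.
  apply: le_trans nl; rewrite ler_nat; apply: leq_trans (jump_at_ge (S k)).
  apply: leq_trans bk.
  by rewrite /b (bigD1_seq l ls (fset_uniq _)) /= leq_maxl.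
have supG_conv : `[2, 3[ `\` lim_sup_set G `<=` conv_set \1_U Lam.
  move=> x [/=]; rewrite in_itv /= => /andP[x2 x3] notG; apply: conv_set_indic.
  (* Only the targets before [k0] matter, and these are bounded. *)
  have [k0 k0P] : exists k0, forall k, (k0 <= k)%N -> ~ G k x.
    apply: contrapT => none; apply: notG => k _; apply: contrapT => noj.
    by apply: none; exists k => j kj Gj; apply: noj; exists j.
  pose b := (\max_(k < k0) (jump_at (S k)).+2)%N.
  apply: sub_finite_set (admissible_finite_below b%:R adm) => l [Ll [k _ Axl]].
  split => //=; rewrite in_itv /=.
  have kk0 : (k < k0)%N.
    by rewrite ltnNge; apply/negP => /k0P; apply; exact: leakingP Axl.
  have : ((jump_at (S k)).+2 <= b)%N.
    exact: (leq_bigmax (F := fun k : 'I_k0 => (jump_at (S k)).+2)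
      (Ordinal kk0)).
  rewrite -(ler_nat R); have := target_sub Axl; rewrite /= in_itv /=.
  by move=> /andP[_ h1] h2; lra.
have E_fin : (lebesgue_measure (\bigcup_(k >= 0) E k) < +oo)%E.
  apply: (@le_lt_trans _ _ (lebesgue_measure (`[0, 1[%classic : set R))).
    apply: le_measure; rewrite ?inE //; last by move=> x [k _ /hitting_sub].
    by apply: bigcup_measurable => k _; exact: mE.
  by rewrite lebesgue_measure_itv /= lte_fin ltr01 -EFinB ltry.
have supE_big : (2^-1%:E <= lebesgue_measure (lim_sup_set E))%E.
  have /cvg_lim <- // := lim_sup_set_cvg (@lebesgue_measure R) E mE E_fin.
  apply: lime_ge; first by apply/cvg_ex; eexists; exact: lim_sup_set_cvg.
  apply: nearW => m; apply: le_trans (hitting_large (S m)) _.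
  apply: le_measure; rewrite ?inE; first exact: mE.
    by apply: bigcup_measurable => k _; exact: mE.
  by move=> x Ex; exists m => /=.
have supG0 : lebesgue_measure (lim_sup_set G) = 0%E.
  apply: lim_sup_set_cvg0 => //.
  apply: (@le_lt_trans _ _ 12%:E); last exact: ltry.
  apply: le_trans (epsilon_trick0 xpredT (_ : 0 <= 12 :> R)); last by [].
  by apply: lee_nneseries => // k _; exact: leaking_small.
have msupE : measurable (lim_sup_set E).
  apply: bigcap_measurable => // k _.
  by apply: bigcup_measurable => j _; exact: mE.
have msupG : measurable (lim_sup_set G).
  apply: bigcap_measurable => // k _.
  by apply: bigcup_measurable => j _; exact: mG.
pose C : set R := `[2, 3[%classic `\` lim_sup_set G.
have mC : measurable C.
  by apply: measurableD => //; exact: measurable_itv.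
have C_big : (1%:E <= lebesgue_measure C)%E.
  have m23 : measurable (`[2, 3[%classic : set R) by exact: measurable_itv.
  have <- : lebesgue_measure (`[2, 3[%classic : set R) = 1%:E.
    rewrite lebesgue_measure_itv /= lte_fin ltr_nat /= -EFinB; congr EFin; lra.
  rewrite (measureDI lebesgue_measure m23 msupG).
  rewrite [X in (_ + X)%E](_ : _ = 0%E) ?adde0 //; apply/eqP.
  rewrite eq_le measure_ge0 andbT -supG0; apply: le_measure; rewrite ?inE //.
  exact: measurableI.
move=> t1; have [] := t1 \1_U.
- exact: lebesgue_measurable_indic.
- by move=> x; rewrite indicE.
- exact: completed_lebesgue_measure_gt0 msupE supE_div supE_big.
- exact: completed_lebesgue_measure_gt0 mC supG_conv C_big.
Qed.

Theorem corollary2p2 (R : realType) (Lam : set R) (hLam : admissible Lam)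
  (hlimsup : forall c : R, 0 < c ->
    limn_esup (fun n : nat => ((unit_count Lam n%:Z)%:R / c ^+ n)%:E) = +oo%E) :
  forall Lam' : set R, admissible Lam' -> Lam `<=` Lam' -> type2 Lam'.
Proof.
move=> Lam' adm' LL'; apply: type2_of_jumps => //.
apply: (superexponential_jump (R := R)) => [n|c B n0 c0].
  exact: count_belowS.
have [n n0n Bn] := limn_esup_pinfty_frequently B n0 (hlimsup c c0).
exists n => //; apply: lt_le_trans Bn _.
by rewrite ler_pM2r ?invr_gt0 ?exprn_gt0 // ler_nat le_unit_count.
Qed.
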